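(* We have $$\sum_{(\lambda,\mu)\in\mathfrak{F}(0,a;q)\times\mathfrak{F}(-a,b;q)}w(\lambda)w(\mu)=\frac{(ab;q)_{\infty}}{(a;q)_{\infty}(b;q)_{\infty}}=\sum_{(\lambda,\mu)\in\mathfrak{F}(0,a,0,b;q)}w(\lambda)w(\mu).$$
   Context: A partition is a finite weakly decreasing sequence of positive integers (its parts); the empty partition is denoted $\epsilon$, and $\#(\lambda)$ is the number of parts of $\lambda$. Notation: $(x;q)_\infty=\prod_{j\ge 0}(1-xq^j)$. A $2$-colored partition is a partition in which each part of size $k$ is colored either $b$ or (only allowed when $k\ge 2$) $ab$, such that the $ab$-colored parts are all distinct in size (for each $k\ge2$ at most one part of size $k$ is $ab$-colored, while $b$-colored parts may repeat). When parts of the same size have different colors, the $ab$-colored one is listed after (below) the $b$-colored ones; $2$-colored partitions are determined by the multiset of colored parts. $\mathfrak{F}(a,b;q)$ denotes the set of all $2$-colored partitions weighted as follows: a $b$-colored part of size $k\ge1$ has weight $b\,q^{k-1}$ (the leftmost cell of its row contributes $b$, the others $q$), an $ab$-colored part of size $k\ge 2$ has weight $ab\,q^{k-2}$ (leftmost cell contributes $b$, rightmost cell contributes $a$, the others $q$), and the weight $w(\mu)$ of $\mu\in\mathfrak{F}(a,b;q)$ is the product of the weights of its parts (the empty partition has weight $1$). The parameters in $\mathfrak{F}(\cdot,\cdot;q)$ are replaced by substitution: in $\mathfrak{F}(-a,b;q)$, a $b$-colored part of size $k$ has weight $bq^{k-1}$ and an $ab$-colored part of size $k\ge2$ has weight $-ab\,q^{k-2}$;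 when the first parameter is $0$, no $ab$-colored parts are allowed, so that $\mathfrak{F}(0,a;q)$ is the set of ordinary partitions in which each part of size $k$ has weight $a\,q^{k-1}$. Finally, $\mathfrak{F}(a,b,c,d;q):=\{(\lambda,\mu)\in\mathfrak{F}(a,b;q)\times\mathfrak{F}(c,d;q):\ \lambda=\epsilon \text{ or the smallest part of }\lambda \text{ is } >\#(\mu)\}$; so $\mathfrak{F}(0,a,0,b;q)$ consists of pairs of ordinary partitions $(\lambda,\mu)$ satisfying this condition, with parts of size $k$ in $\lambda$ weighted $aq^{k-1}$ and in $\mu$ weighted $bq^{k-1}$. The identities may be read as identities of formal power series in $a,b,q$. *)

(* Defs.v *)
From HB Require Import structures.
From mathcomp Require Import all_boot all_order all_algebra.
From mathcomp Require Import boolp classical_sets functions cardinality fsbigop.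

Set Implicit Arguments.
Unset Strict Implicit.
Unset Printing Implicit Defensive.

Import GRing.Theory.
Local Open Scope ring_scope.

(* Univariate formal power series; [f n] is the coefficient of X^n. Several    *)
(* variables are obtained by iterating the construction.                      *)
Record fps (R : Type) := Fps { coef_fps :> nat -> R }.

Lemma fpsP (R : Type) (f g : fps R) : (forall n, f n = g n) <-> f = g.
Proof.
split=> [|-> //]; case: f g => [f] [g] /= fg.
by congr Fps; apply/funext.
Qed.

HB.instance Definition _ (R : Type) := gen_eqMixin (fps R).
HB.instance Definition _ (R : Type) := gen_choiceMixin (fps R).

Section FpsZmodule.
Variable R : zmodType.
Implicit Types f g h : fps R.

Definition fps_zero : fps R := Fps (fun=> 0).
Definition fps_opp f := Fps (fun n => - f n).
Definition fps_add f g := Fps (fun n => f n + g n).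

Fact fps_addA : associative fps_add.
Proof. by move=> f g h; apply/fpsP => n /=; rewrite addrA. Qed.
Fact fps_addC : commutative fps_add.
Proof. by move=> f g; apply/fpsP => n /=; rewrite addrC. Qed.
Fact fps_add0 : left_id fps_zero fps_add.
Proof. by move=> f; apply/fpsP => n /=; rewrite add0r. Qed.
Fact fps_addN : left_inverse fps_zero fps_opp fps_add.
Proof. by move=> f; apply/fpsP => n /=; rewrite addNr. Qed.

HB.instance Definition _ :=
  GRing.isZmodule.Build (fps R) fps_addA fps_addC fps_add0 fps_addN.

Lemma coef_fps0 n : (0 : fps R) n = 0. Proof. by []. Qed.
Lemma coef_fpsN f n : (- f) n = - f n. Proof. by []. Qed.
Lemma coef_fpsD f g n : (f + g) n = f n + g n. Proof. by []. Qed.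

End FpsZmodule.

Section FpsRing.
Variable R : comNzRingType.
Implicit Types f g h : fps R.

(* The series X^0 with coefficient c, and the variable X.                     *)
Definition fpsC (c : R) : fps R := Fps (fun n => if n is 0 then c else 0).
Definition fpsX : fps R := Fps (fun n => (n == 1)%:R).

Definition fps_one : fps R := fpsC 1.
Definition fps_mul f g : fps R :=
  Fps (fun n => \sum_(i < n.+1) f i * g (n - i)%N).

(* Products are computed coefficientwise on polynomial truncations, which     *)
(* reduces the ring axioms to those of {poly R}.                              *)
Let eqt N (p : {poly R}) f := forall i, (i < N)%N -> p`_i = f i.
Let trunc N f : {poly R} := \poly_(i < N) f i.

Let eqt_trunc N f : eqt N (trunc N f) f.
Proof. by move=> i iN; rewrite coef_poly iN. Qed.

Let eqt_mul N p q f g : eqt N p f -> eqt N q g -> eqt N (p * q) (fps_mul f g).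
Proof.
move=> pf qg i iN; rewrite coefM /=; apply: eq_bigr => j _.
rewrite pf ?qg //; first by rewrite (leq_ltn_trans (leq_subr _ _)).
by rewrite (leq_ltn_trans _ iN) // -ltnS.
Qed.

Let eqt_one N : eqt N 1 fps_one.
Proof. by move=> i _; rewrite coef1; case: i. Qed.

Let eqt_add N p q f g : eqt N p f -> eqt N q g -> eqt N (p + q) (f + g).
Proof. by move=> pf qg i iN; rewrite coefD pf ?qg. Qed.

Let eqt_eq f g : (forall N, exists p, eqt N p f /\ eqt N p g) -> f = g.
Proof.
by move=> fg; apply/fpsP => n; case: (fg n.+1) => p [pf pg]; rewrite -pf ?pg.
Qed.

Fact fps_mulA : associative fps_mul.
Proof.
move=> f g h; apply: eqt_eq => N.
exists (trunc N f * (trunc N g * trunc N h)); split.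
  by do 2?apply: eqt_mul.
by rewrite mulrA; do 2?apply: eqt_mul.
Qed.
Fact fps_mulC : commutative fps_mul.
Proof.
move=> f g; apply: eqt_eq => N; exists (trunc N f * trunc N g); split.
  exact: eqt_mul.
by rewrite mulrC; exact: eqt_mul.
Qed.
Fact fps_mul1 : left_id fps_one fps_mul.
Proof.
move=> f; apply: eqt_eq => N; exists (1 * trunc N f); split.
  exact: eqt_mul.
by rewrite mul1r.
Qed.
Fact fps_mulDl : left_distributive fps_mul +%R.
Proof.
move=> f g h; apply: eqt_eq => N.
exists ((trunc N f + trunc N g) * trunc N h); split.
  by apply: eqt_mul => //; exact: eqt_add.
by rewrite mulrDl; apply: eqt_add; exact: eqt_mul.
Qed.
Fact fps_one_neq0 : fps_one != 0.
Proof.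
by apply/eqP => /(congr1 (fun f : fps R => f 0%N))/eqP; rewrite /= oner_eq0.
Qed.

HB.instance Definition _ := GRing.Zmodule_isComNzRing.Build (fps R)
  fps_mulA fps_mulC fps_mul1 fps_mulDl fps_one_neq0.

Lemma coef_fps1 n : (1 : fps R) n = (n == 0%N)%:R. Proof. by case: n. Qed.
Lemma coef_fpsM f g n : (f * g) n = \sum_(i < n.+1) f i * g (n - i)%N.
Proof. by []. Qed.

Lemma coef_fpsM0 f g : (f * g) 0%N = f 0%N * g 0%N.
Proof. by rewrite coef_fpsM big_ord1. Qed.

Lemma coef_fpsMC f c n : (f * fpsC c) n = f n * c.
Proof.
rewrite coef_fpsM big_ord_recr /= subnn big1 ?add0r// => i _.
by rewrite -[(n - i)%N]prednK ?subn_gt0//= mulr0.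
Qed.

Lemma fpsC_exp c k : fpsC c ^+ k = fpsC (c ^+ k).
Proof.
elim: k => [|k IH]; first by rewrite !expr0.
rewrite !exprSr IH; apply/fpsP => n; rewrite coef_fpsMC.
by case: n => //= n; rewrite mul0r.
Qed.

Lemma coef_fpsMX f n : (f * fpsX) n = if n is m.+1 then f m else 0.
Proof.
case: n => [|n]; first by rewrite coef_fpsM0 /= mulr0.
rewrite coef_fpsM big_ord_recr big_ord_recr /= subnn subSnn eqxx mulr1 mulr0.
rewrite addr0 big1 ?add0r// => i _.
have ni0 : (0 < n - i)%N by rewrite subn_gt0.
by rewrite (subSn (ltnW (ltn_ord i))) eqSS gtn_eqF ?mulr0.
Qed.

Lemma coef_fpsMXn f k n :
  (f * fpsX ^+ k) n = if (n < k)%N then 0 else f (n - k)%N.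
Proof.
elim: k n => [|k IH] n; first by rewrite expr0 mulr1 subn0.
by rewrite exprSr mulrA coef_fpsMX; case: n => // n; rewrite IH.
Qed.

End FpsRing.

Section FpsUnitRing.
Variable R : comUnitRingType.
Implicit Types f g : fps R.

Definition fps_unit : {pred fps R} := fun f => f 0%N \is a GRing.unit.

(* The first n coefficients of 1/f, from the recurrence                       *)
(* g_n = - f_0^-1 * \sum_(i < n) g_i * f_(n - i).                             *)
Fixpoint fps_inv_coefs f n : seq R :=
  if n is m.+1 then
    let s := fps_inv_coefs f m in
    rcons s (if m is 0 then (f 0%N)^-1
             else - (f 0%N)^-1 * \sum_(i < m) s`_i * f (m - i)%N)
  else [::].

Definition fps_inv f : fps R :=
  if f \in fps_unit then Fps (fun n => (fps_inv_coefs f n.+1)`_n) else f.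

Let size_inv_coefs f n : size (fps_inv_coefs f n) = n.
Proof. by elim: n => //= n IH; rewrite size_rcons IH. Qed.

Let nth_inv_coefs f n i :
  (i < n)%N -> (fps_inv_coefs f n)`_i = (fps_inv_coefs f i.+1)`_i.
Proof.
elim: n => //= n IH; rewrite ltnS leq_eqVlt => /orP[/eqP -> //|i_n].
by rewrite nth_rcons size_inv_coefs i_n IH.
Qed.

Fact fps_mulVf : {in fps_unit, left_inverse 1 fps_inv *%R}.
Proof.
move=> f f_unit; apply/fpsP => n; rewrite /fps_inv f_unit.
rewrite coef_fpsM coef_fps1 big_ord_recr /= subnn.
rewrite nth_rcons size_inv_coefs ltnn eqxx.
case: n => [|n]; first by rewrite big_ord0 add0r mulVr.
rewrite mulrAC mulNr mulVr // mulN1r.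
apply/eqP; rewrite subr_eq add0r; apply/eqP/eq_bigr => i _.
by rewrite [in RHS]nth_inv_coefs.
Qed.
Fact fps_unitPl f g : g * f = 1 -> fps_unit f.
Proof.
move=> /(congr1 (fun h : fps R => h 0%N)); rewrite coef_fpsM0 coef_fps1 /=.
by move=> gf1; apply/unitrPr; exists (g 0%N); rewrite mulrC.
Qed.
Fact fps_inv_out : {in [predC fps_unit], fps_inv =1 id}.
Proof. by move=> f /negPf f_unit; rewrite /fps_inv f_unit. Qed.

HB.instance Definition _ := GRing.ComNzRing_hasMulInverse.Build (fps R)
  fps_mulVf fps_unitPl fps_inv_out.

Lemma fps_unitE f : (f \is a GRing.unit) = (f 0%N \is a GRing.unit).
Proof. by []. Qed.

End FpsUnitRing.

(* R[[a, b, q]], represented as R[[q]][[b]][[a]]: for [s : fps3 R], the        *)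
(* coefficient of a^i b^j q^n in s is [s i j n].                              *)
Notation fps3 R := (fps (fps (fps R))).

Section Fps3.
Variable R : comUnitRingType.

Definition fps3_a : fps3 R := fpsX _.
Definition fps3_b : fps3 R := fpsC (fpsX _).
Definition fps3_q : fps3 R := fpsC (fpsC (fpsX _)).

(* Limit for the topology of coefficientwise stabilization; a coefficient     *)
(* that is not eventually constant is given the dummy value 0.                *)
Definition fps3_lim (u : nat -> fps3 R) : fps3 R :=
  Fps (fun i => Fps (fun j => Fps (fun n =>
    xget 0 [set c | exists N0, forall N, (N0 <= N)%N -> u N i j n = c]))).

(* Coefficientwise summable families: only finitely many terms contribute to  *)
(* any given monomial. [fps3_sum] is meaningful on such families only.        *)
Definition fps3_summable (I : choiceType) (A : set I) (F : I -> fps3 R) :=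
  forall i j n, finite_set [set p | A p /\ F p i j n != 0].

Definition fps3_sum (I : choiceType) (A : set I) (F : I -> fps3 R) : fps3 R :=
  Fps (fun i => Fps (fun j => Fps (fun n => \sum_(p \in A) F p i j n))).

Definition qpoch (x q : fps3 R) : fps3 R :=
  fps3_lim (fun N => \prod_(k < N) (1 - x * q ^+ k)).

(* The infinite product (x; q)_oo converges, whatever x.                      *)
Lemma qpochE (x : fps3 R) (N i j n : nat) : (n < N)%N ->
  qpoch x fps3_q i j n = (\prod_(k < N) (1 - x * fps3_q ^+ k)) i j n.
Proof.
move=> nN; pose u N := \prod_(k < N) (1 - x * fps3_q ^+ k).
have uS M : (n < M)%N -> u M.+1 i j n = u M i j n.
  have -> : u M.+1 = u M - u M * x * fps3_q ^+ M.
    by rewrite /u big_ord_recr /= mulrBr mulr1 mulrA.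
  move=> nM.
  rewrite !coef_fpsD !coef_fpsN /fps3_q !fpsC_exp !coef_fpsMC coef_fpsMXn nM.
  by rewrite subr0.
have uE M : (N <= M)%N -> u M i j n = u N i j n.
  elim: M => [|M IH]; first by rewrite leqn0 => /eqP ->.
  rewrite leq_eqVlt => /orP[/eqP -> //|]; rewrite ltnS => NM.
  by rewrite uS ?IH// (leq_trans nN).
rewrite /qpoch /fps3_lim /=; apply: xget_unique => [|c [N0 N0c]].
  by exists N => M; exact: uE.
by rewrite -(N0c (maxn N0 N)) ?leq_maxl// uE// leq_maxr.
Qed.

(* The denominators occurring in the identity are invertible.                 *)
Lemma qpoch_unit (x : fps3 R) : x 0%N 0%N 0%N = 0 ->
  qpoch x fps3_q \is a GRing.unit.
Proof.
move=> x0; rewrite !fps_unitE (@qpochE _ 1%N)// big_ord1 expr0 mulr1.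
by rewrite !coef_fpsD !coef_fpsN x0 subr0 unitr1.
Qed.

End Fps3.

(* Colored parts are pairs (k, c): k is the size, and c is [true] for color   *)
(* ab, [false] for color b.                                                   *)
Definition part_ok (p : nat * bool) : bool :=
  if p.2 then (2 <= p.1)%N else (1 <= p.1)%N.

Definition part_geq (p p' : nat * bool) : bool :=
  (p'.1 < p.1)%N || (p'.1 == p.1) && (p.2 ==> p'.2).

Definition is_colpart (s : seq (nat * bool)) : bool :=
  [&& all part_ok s, sorted part_geq s & uniq [seq p.1 | p <- s & p.2]].

Record colpart := ColPart { parts :> seq (nat * bool); _ : is_colpart parts }.

HB.instance Definition _ := [isSub for parts].
HB.instance Definition _ := [Choice of colpart by <:].

Definition num_parts (mu : colpart) : nat := size mu.

(* Parts are listed in decreasing order; the value is 0 on the empty          *)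
(* partition.                                                                 *)
Definition smallest_part (mu : colpart) : nat := last 0%N [seq p.1 | p <- mu].

Section Weights.
Variable S : comNzRingType.

(* The underlying set of F(x, y; q): ab-colored parts are allowed only when   *)
(* the first parameter x is nonzero.                                          *)
Definition frakF (x y : S) : set colpart :=
  [set mu | x = 0 -> forall p, p \in (mu : seq _) -> ~~ p.2].

Definition weight (x y q : S) (mu : colpart) : S :=
  \prod_(p <- mu) (if p.2 then x * y * q ^+ (p.1 - 2) else y * q ^+ (p.1 - 1)).

Definition frakF4 (x y z t : S) : set (colpart * colpart) :=
  [set p | [/\ frakF x y p.1, frakF z t p.2 &
    parts p.1 = [::] \/ (num_parts p.2 < smallest_part p.1)%N]].

End Weights.

(* Main.v *)
(* Weights of partitions are homogeneous in (a, b, q) of total degree the     *)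
(* size of the partition, so all sums are graded and may be computed with     *)
(* finite truncations.  Let U_N be the sum of F(x, y; q) restricted to        *)
(* b-parts > N and ab-parts > N + 1.  Removing the smallest admissible parts  *)
(* N + 1 (color b) and N + 2 (color ab) gives                                 *)
(*   U_N (1 - y q^N) = (1 + x y q^N) U_(N+1),                                 *)
(* and U_N -> 1, hence U_0 (y; q)_oo = (- x y; q)_oo.  In the pair sum, the   *)
(* partitions lambda with parts > m = #(mu) contribute                        *)
(* (a; q)_m / (a; q)_oo, and the sum V_N over uncolored mu with parts > N of  *)
(* w(mu) (a; q)_#(mu) satisfies the recurrence of U_N for x = - a: remove a   *)
(* part N + 1, and use that adding 1 to all parts multiplies the weight by    *)
(* q^#(mu).  This replaces an appeal to the q-binomial theorem.               *)
Require Import Defs.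
From HB Require Import structures.
From mathcomp Require Import all_boot all_order all_algebra.
From mathcomp Require Import boolp classical_sets functions cardinality fsbigop.

Set Implicit Arguments.
Unset Strict Implicit.
Unset Printing Implicit Defensive.

Import GRing.Theory.
Local Open Scope classical_set_scope.
Local Open Scope ring_scope.

(** One first-order recurrence evaluates every sum. Let [U N] be the weighted sum over the
    partitions in [parts_gt N]. Peeling off the least admissible part gives U_N (1 - y q^N) = (1 - z
    q^N) U_(N+1), and U_N tends to 1 coefficientwise, hence U_0 (y; q)_oo = (z; q)_oo
    ([qpoch_recurrence]).

    For unrestricted pairs the sum is a product. By [qpoch_sum_weight], the factor for F(0, a; q)
    has y = a, z = 0 and equals 1 / (a; q)_oo, and the factor for F(-a, b; q) has y = b, z = ab and
    equals (ab; q)_oo / (b; q)_oo.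

    For restricted pairs, fix mu with m parts. The admissible lambda contribute (a; q)_m / (a;
    q)_oo, by stopping the recurrence with z = 0 after m steps ([fps3_sum_weight0_parts_gt]). There
    remains the sum of w(mu) (a; q)_m over ordinary partitions mu, which is the q-binomial theorem;
    [qpoch_sum_qfact] derives it from the same recurrence with y = b, z = ab.

    Infinite sums may be split, reindexed and multiplied because a partition of size K has a weight
    of total order at least K, and finitely many partitions have size at most K. *)

(** * Coefficients of products and the total-degree filtration *)

Section Coefficients.
Variable R : comUnitRingType.
Implicit Types f g : fps3 R.

Lemma coef3_sum (I : Type) (r : seq I) (F : I -> fps3 R) i j n :
  (\sum_(p <- r) F p) i j n = \sum_(p <- r) F p i j n.
Proof. by elim: r => [|p r IH]; rewrite ?big_nil// !big_cons !coef_fpsD IH. Qed.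

Lemma coef3_fsum (I : choiceType) (D : set I) (F : I -> fps3 R) i j n :
  finite_set D -> (\sum_(p \in D) F p) i j n = \sum_(p \in D) F p i j n.
Proof. by move=> Dfin; rewrite !fsbig_finite//; apply: coef3_sum. Qed.

Lemma coef3M f g i j n :
  (f * g) i j n = \sum_(i' < i.+1) \sum_(j' < j.+1) \sum_(n' < n.+1)
    f i' j' n' * g (i - i')%N (j - j')%N (n - n')%N.
Proof.
rewrite coef_fpsM -(big_mkord predT (fun i' => f i' * g (i - i')%N)).
have coef2_sum (r : seq nat) (F : nat -> fps (fps R)) :
    (\sum_(p <- r) F p) j n = \sum_(p <- r) F p j n.
  by elim: r => [|p r IH]; rewrite ?big_nil// !big_cons !coef_fpsD IH.
rewrite coef2_sum big_mkord; apply: eq_bigr => i' _; rewrite coef_fpsM.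
rewrite -(big_mkord predT (fun j' => f i' j' * g (i - i')%N (j - j')%N)).
have coef1_sum (r : seq nat) (F : nat -> fps R) :
    (\sum_(p <- r) F p) n = \sum_(p <- r) F p n.
  by elim: r => [|p r IH]; rewrite ?big_nil// !big_cons !coef_fpsD IH.
by rewrite coef1_sum big_mkord; apply: eq_bigr => j' _; rewrite coef_fpsM.
Qed.

Lemma eq_coef3M f f' g g' i j n :
    (forall i' j' n', (i' <= i)%N -> (j' <= j)%N -> (n' <= n)%N ->
      f i' j' n' = f' i' j' n') ->
    (forall i' j' n', (i' <= i)%N -> (j' <= j)%N -> (n' <= n)%N ->
      g i' j' n' = g' i' j' n') ->
  (f * g) i j n = (f' * g') i j n.
Proof.
move=> ff gg; rewrite !coef3M; apply: eq_bigr => i' _; apply: eq_bigr => j' _.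
by apply: eq_bigr => n' _; rewrite ff ?gg ?leq_subr // -ltnS.
Qed.

(** Membership in the K-th power of the ideal generated by a, b and q. *)
Definition order_ge K f := forall i j n, (i + j + n < K)%N -> f i j n = 0.

Lemma order_geM K L f g :
  order_ge K f -> order_ge L g -> order_ge (K + L) (f * g).
Proof.
move=> fK gL i j n ijn; rewrite coef3M.
rewrite big1// => i' _; rewrite big1// => j' _; rewrite big1// => n' _.
have [lt_K|le_K] := ltnP (i' + j' + n') K; first by rewrite fK ?mul0r.
rewrite gL ?mulr0//.
have := ltn_ord i'; have := ltn_ord j'; have := ltn_ord n'; rewrite !ltnS.
move=> n'n j'j i'i; rewrite -(ltn_add2l (i' + j' + n')%N).
rewrite [X in (X < _)%N]addnACA [X in (X + _ < _)%N]addnACA !subnKC//.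
by rewrite (leq_trans ijn)// leq_add2r.
Qed.

Lemma order_geMr K f g : order_ge K f -> order_ge K (f * g).
Proof. by move=> fK; rewrite -[K]addn0; apply: order_geM. Qed.

Lemma order_geX K f : order_ge 1 f -> order_ge K (f ^+ K).
Proof.
move=> f1; elim: K => // K IH; rewrite exprSr -addn1; exact: order_geM.
Qed.

Lemma order_ge0 K : order_ge K 0. Proof. by []. Qed.

Lemma order_geN K f : order_ge K f -> order_ge K (- f).
Proof. by move=> fK i j n ijn; rewrite !coef_fpsN fK ?oppr0. Qed.

Lemma order_ge_a : order_ge 1 (fps3_a R).
Proof. by move=> [] [] []. Qed.

Lemma order_ge_b : order_ge 1 (fps3_b R).
Proof. by move=> [] [] []. Qed.

Lemma order_ge_q : order_ge 1 (fps3_q R).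
Proof. by move=> [] [] []. Qed.

Lemma coef3_mulqXn f K i j n :
  (n < K)%N -> (f * fps3_q R ^+ K) i j n = 0.
Proof. by move=> nK; rewrite /fps3_q !fpsC_exp !coef_fpsMC coef_fpsMXn nK. Qed.

End Coefficients.

(** * Infinite sums of graded families *)

Section GradedSums.
Variables (R : comUnitRingType) (I : choiceType) (deg : I -> nat).
Hypothesis deg_fin : forall K, finite_set [set p | deg p <= K]%N.
Implicit Types (A B : set I) (F G : I -> fps3 R).

Definition graded F := forall p, order_ge (deg p) (F p).

Lemma graded_summable A F : graded F -> fps3_summable A F.
Proof.
move=> grF i j n; apply: sub_finite_set (deg_fin (i + j + n)) => p [_ /=].
by apply: contraR; rewrite -ltnNge => /grF ->.
Qed.

Lemma sum_cut A F K i j n : graded F -> (i + j + n <= K)%N ->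
  fps3_sum A F i j n = \sum_(p \in A `&` [set p | deg p <= K]%N) F p i j n.
Proof.
move=> grF ijnK; symmetry; apply: fsbig_widen => [p []//|p [Ap /= nAp]].
apply: grF; rewrite ltnNge; apply/negP => pijn; apply: nAp.
by split=> //=; rewrite (leq_trans pijn).
Qed.

Lemma finite_cut A K : finite_set (A `&` [set p | deg p <= K]%N).
Proof. exact: finite_setIr. Qed.
Hint Resolve finite_cut : core.

Lemma eq_fps3_sum A F G : (forall p, A p -> F p = G p) ->
  fps3_sum A F = fps3_sum A G.
Proof.
move=> FG; apply/fpsP => i; apply/fpsP => j; apply/fpsP => n /=.
by apply: eq_fsbigr => p; rewrite inE => /FG ->.
Qed.

Lemma fps3_sum_widen A B F : A `<=` B -> (forall p, B p -> ~ A p -> F p = 0) ->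
  fps3_sum A F = fps3_sum B F.
Proof.
move=> AB F0; apply/fpsP => i; apply/fpsP => j; apply/fpsP => n /=.
by apply: fsbig_widen => // p [Bp nAp] /=; rewrite F0.
Qed.

Lemma graded_mull g F : graded F -> graded (fun p => g * F p).
Proof. by move=> grF p; rewrite mulrC; apply: order_geMr. Qed.

(** A coefficient of the product involves only coefficients of the sum at smaller or equal
    exponents, so one finite cut serves for all of them. *)
Lemma fps3_sum_distrr A g F : graded F ->
  g * fps3_sum A F = fps3_sum A (fun p => g * F p).
Proof.
move=> grF; apply/fpsP => i; apply/fpsP => j; apply/fpsP => n.
set D := A `&` [set p | deg p <= i + j + n]%N.
have Dfin : finite_set D by exact: finite_cut.
have -> : (g * fps3_sum A F) i j n
    = (g * \sum_(p \in D) F p) i j n.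
  apply: eq_coef3M => // i' j' n' i'i j'j n'n.
  rewrite (@sum_cut _ _ (i + j + n)) ?leq_add//.
  by rewrite coef3_fsum.
rewrite fsbig_distrr// coef3_fsum//.
rewrite (sum_cut _ (K := (i + j + n)%N) (graded_mull _ grF))//.
Qed.

Lemma fps3_sumD A F G : graded F -> graded G ->
  fps3_sum A (fun p => F p + G p) = fps3_sum A F + fps3_sum A G.
Proof.
move=> grF grG; apply/fpsP => i; apply/fpsP => j; apply/fpsP => n.
rewrite !coef_fpsD !(@sum_cut _ _ (i + j + n))//.
  by rewrite -fsbig_split.
by move=> p i' j' n' h; rewrite !coef_fpsD grF ?grG ?addr0.
Qed.

Lemma fps3_sumU A B F : graded F -> A `&` B `<=` set0 ->
  fps3_sum (A `|` B) F = fps3_sum A F + fps3_sum B F.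
Proof.
move=> grF AB0; apply/fpsP => i; apply/fpsP => j; apply/fpsP => n.
rewrite !coef_fpsD !(@sum_cut _ _ (i + j + n))// setIUl fsbigU0//.
by move=> p [[Ap _] [Bp _]]; apply: AB0.
Qed.

End GradedSums.

Lemma fps3_sum_image (R : comUnitRingType) (I J : choiceType) (h : I -> J)
    (A : set I) (F : J -> fps3 R) : set_inj A h ->
  fps3_sum (h @` A) F = fps3_sum A (F \o h).
Proof.
move=> hinj; apply/fpsP => i; apply/fpsP => j; apply/fpsP => n /=.
exact: fsbig_image.
Qed.

(** Fubini over a fibred index set; it is needed because the range of lambda depends on the number
    of parts of mu. *)
Lemma fps3_sum_dep (R : comUnitRingType) (I J : choiceType)
    (degI : I -> nat) (degJ : J -> nat) (A : J -> set I)
    (F : I -> fps3 R) (G : J -> fps3 R) :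
    (forall K, finite_set [set p | degI p <= K]%N) ->
    (forall K, finite_set [set p | degJ p <= K]%N) ->
    graded degI F -> graded degJ G ->
  fps3_sum [set p | A p.2 p.1] (fun p => F p.1 * G p.2)
    = fps3_sum setT (fun q => fps3_sum (A q) F * G q).
Proof.
move=> finI finJ grF grG; apply/fpsP => i; apply/fpsP => j; apply/fpsP => n.
set K := (i + j + n)%N.
pose P := [set p | degI p <= K]%N; pose Q := [set p | degJ p <= K]%N.
(* Extension by zero of the fibred sum to the rectangle of [P] and [Q]; terms whose two degrees add
   up to more than [K] vanish. *)
pose H (q : J) (p : I) := if p \in A q then (F p * G q) i j n else 0.
have H0 q p : (K < degI p + degJ q)%N -> H q p = 0.
  by move=> Kpq; rewrite /H (order_geM (grF p) (grG q))//; case: ifP.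
have finP : finite_set P by exact: finI.
have finQ : finite_set Q by exact: finJ.
change (\sum_(p \in [set p | A p.2 p.1]) (F p.1 * G p.2) i j n
  = (fps3_sum setT (fun q => fps3_sum (A q) F * G q)) i j n).
transitivity (\sum_(q \in Q) \sum_(p \in P) H q p).
  rewrite exchange_fsbig// pair_fsbig//.
  rewrite [LHS]fsbig_mkcond [RHS]fsbig_mkcond; apply: eq_fsbigr => -[p q] _.
  rewrite /patch in_setX ![(p, q).1]/= ![(p, q).2]/=.
  have -> : ((p, q) \in [set p | A p.2 p.1]) = (p \in A q).
    by apply/idP/idP; rewrite !inE.
  rewrite -/(H q p); case: ifP => // /negP pq; apply: H0.
  rewrite ltnNge; apply/negP => pqK; apply: pq.
  apply/andP; split; rewrite inE /P /Q /=.
    by rewrite (leq_trans _ pqK)// leq_addr.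
  by rewrite (leq_trans _ pqK)// leq_addl.
have sumH q : \sum_(p \in P) H q p = (fps3_sum (A q) F * G q) i j n.
  rewrite mulrC (fps3_sum_distrr finI)//.
  rewrite (sum_cut (K := K) _ (graded_mull _ grF))// setIC fsbig_mkcondr.
  by apply: eq_fsbigr => p _; rewrite /H mulrC.
transitivity (\sum_(q \in Q) (fps3_sum (A q) F * G q) i j n).
  by apply: eq_fsbigr => q _; exact: sumH.
change (\sum_(q \in Q) (fps3_sum (A q) F * G q) i j n
  = \sum_(q \in setT) (fps3_sum (A q) F * G q) i j n).
apply: fsbig_widen => // q [_ /negP qQ]; apply: etrans (esym (sumH q)) _.
by apply: fsbig1 => p _; apply: H0; rewrite ltn_addl// ltnNge.
Qed.

(** * From the recurrence to infinite products *)

Lemma prod_recurrence (S : comPzRingType) (U Y Z : nat -> S) :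
    (forall n, U n * Y n = Z n * U n.+1) ->
  forall N, U 0%N * \prod_(k < N) Y k = \prod_(k < N) Z k * U N.
Proof.
move=> UYZ; elim=> [|N IH]; first by rewrite !big_ord0 mulr1 mul1r.
by rewrite !big_ord_recr /= mulrA IH -!mulrA UYZ.
Qed.

Section Recurrence.
Variable R : comUnitRingType.
Implicit Types (y z : fps3 R) (U : nat -> fps3 R).
Local Notation q := (fps3_q R).

(** No limit is taken: at q^n only the first n + 1 factors of each infinite product matter, and
    [U n.+1] already agrees with 1 there. *)
Lemma qpoch_recurrence y z U :
    (forall N, U N * (1 - y * q ^+ N) = (1 - z * q ^+ N) * U N.+1) ->
    (forall N i j n, (n < N)%N -> U N i j n = (1 : fps3 R) i j n) ->
  U 0%N * qpoch y q = qpoch z q.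
Proof.
move=> Urec Ulim.
have UE := prod_recurrence Urec.
apply/fpsP => i; apply/fpsP => j; apply/fpsP => n.
transitivity ((U 0%N * \prod_(k < n.+1) (1 - y * q ^+ k)) i j n).
  by apply: eq_coef3M => // i' j' n' _ _ n'n; rewrite (@qpochE _ _ n.+1)//.
rewrite UE (@qpochE _ _ n.+1)// -[in RHS](mulr1 (\prod_(k < _) _)).
by apply: eq_coef3M => // i' j' n' _ _ n'n; apply: Ulim.
Qed.

Lemma qpoch0 : qpoch 0 q = 1.
Proof.
apply/fpsP => i; apply/fpsP => j; apply/fpsP => n.
by rewrite (@qpochE _ _ n.+1)// big1// => k _; rewrite mul0r subr0.
Qed.

End Recurrence.

(** * Sizes and weights of colored partitions *)

Definition psize (mu : colpart) : nat := sumn [seq p.1 | p <- parts mu].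

Lemma colpart_ok (mu : colpart) p : p \in parts mu -> part_ok p.
Proof. by case: mu => s /= /and3P[/allP sok _ _]; apply: sok. Qed.

Lemma part_ok_gt0 p : part_ok p -> (0 < p.1)%N.
Proof. by rewrite /part_ok; case: p.2 => // /ltnW. Qed.

Lemma finite_bounded_seq (T : choiceType) (s : seq T) L :
  finite_set [set t : seq T | (size t <= L)%N /\ {subset t <= s}].
Proof.
elim: L => [|L IH].
  apply: (@sub_finite_set _ _ [set [::]]); last exact: finite_set1.
  by move=> [|x t] [].
apply: (@sub_finite_set _ _ ([set [::]] `|`
  [set x :: t | x in [set` s] & t in
     [set t : seq T | (size t <= L)%N /\ {subset t <= s}]])).
  move=> [|x t] [/= tL ts]; [by left | right].
  exists x; first by apply: ts; rewrite inE eqxx.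
  by exists t => //; split=> // z zt; apply: ts; rewrite inE zt orbT.
rewrite finite_setU; split; first exact: finite_set1.
exact: finite_image2.
Qed.

(** Parts are positive, so both the number of parts and each part are at most [K]. *)
Lemma finite_psize K : finite_set [set mu : colpart | psize mu <= K]%N.
Proof.
pose s := [seq (k, c) | k <- iota 0 K.+1, c <- [:: true; false]].
apply: (@sub_finite_set _ _ (parts @^-1`
  [set t | (size t <= K)%N /\ {subset t <= s}])); last first.
  apply: finite_preimage; last exact: finite_bounded_seq.
  by move=> mu nu _ _; apply: val_inj.
move=> mu /= muK; split.
  apply: leq_trans muK; rewrite /psize.
  have := @colpart_ok mu; elim: (parts mu) => //= p t IH tok.
  rewrite -add1n leq_add ?part_ok_gt0 ?tok ?inE ?eqxx// IH// => p' p't.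
  by rewrite tok// inE p't orbT.
move=> p pmu; have pK : (p.1 <= K)%N.
  apply: leq_trans muK; rewrite /psize.
  elim: (parts mu) pmu => //= p' t IH; rewrite inE => /orP[/eqP <-|/IH pt].
    exact: leq_addr.
  exact: leq_trans pt (leq_addl _ _).
by apply/allpairsP; exists p; rewrite mem_iota ltnS pK; case: p {pmu pK} => ? [].
Qed.

Section Weights.
Variables (R : comUnitRingType) (x y : fps3 R).
Local Notation q := (fps3_q R).
Hypotheses (x1 : order_ge 1 x) (y1 : order_ge 1 y).

Lemma graded_weight : graded psize (weight x y q).
Proof.
move=> mu; rewrite /psize /weight; have := @colpart_ok mu.
elim: (parts mu) => [|p s IH] sok /=; first by rewrite big_nil.
rewrite big_cons; apply: order_geM; last first.
  by apply: IH => p' p's; apply: sok; rewrite inE p's orbT.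
have := sok p; rewrite inE eqxx /part_ok => /(_ isT).
case: p.2 => p_ok.
  rewrite -[p.1](subnKC p_ok); apply: order_geM; last first.
    by rewrite addKn; apply: order_geX; apply: order_ge_q.
  by rewrite -[2%N]/(1 + 1)%N; apply: order_geM.
rewrite -{1}[p.1](subnKC p_ok); apply: order_geM => //.
by apply: order_geX; apply: order_ge_q.
Qed.

Lemma weight_rcons (mu nu : colpart) p : parts mu = rcons nu p -> weight x y q mu =
  weight x y q nu * (if p.2 then x * y * q ^+ (p.1 - 2) else y * q ^+ (p.1 - 1)).
Proof. by rewrite /weight => ->; rewrite -cats1 big_cat big_seq1. Qed.

(** This allows sums over [frakF] to range over all colored partitions, whether or not [x] is 0. *)
Lemma weight_notin_frakF mu : ~ frakF x y mu -> weight x y q mu = 0.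
Proof.
move=> /not_implyP[x0] /existsNP[p] /not_implyP[pmu /negP].
by rewrite negbK => p2; rewrite /weight (big_rem p pmu) /= p2 x0 !mul0r.
Qed.

End Weights.

(** * Removing the least admissible part *)

Definition above (P : pred (nat * bool)) : set colpart :=
  [set mu | all P (parts mu)].

Lemma part_geq_trans : transitive part_geq.
Proof.
move=> [k c] [l d] [m e]; rewrite /part_geq /=.
case/orP=> [kl|/andP[/eqP -> dc]] /orP[mk|/andP[/eqP -> ce]].
- by rewrite (ltn_trans mk).
- by rewrite kl.
- by rewrite mk.
- by rewrite ltnn eqxx /=; move: c d e dc ce => [] [] [].
Qed.

Lemma part_geq_anti p p' : part_geq p p' -> part_geq p' p -> p = p'.
Proof.
case: p p' => [k c] [l d]; rewrite /part_geq /= eq_sym.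
case: (ltngtP k l) => //= -> cd dc; congr pair.
by apply/idP/idP => h; [move: cd|move: dc]; rewrite h.
Qed.

Section RemoveLeast.
Variables (P : pred (nat * bool)) (p : nat * bool).
Hypotheses (p_ok : part_ok p) (Pp : P p).
Hypothesis p_least : forall p', part_ok p' -> P p' -> part_geq p' p.

(** What may remain once one copy of [p] is removed: an ab-colored [p] cannot recur, since
    ab-colored parts are distinct, but a b-colored one can. *)
Let P' p' := P p' && ~~ (p.2 && (p' == p)).

Let is_colpart_rcons (nu : colpart) : above P' nu -> is_colpart (rcons nu p).
Proof.
case: nu => s /= s_col; rewrite /above /= => /allP sP'.
have/and3P[sok ssorted suniq] := s_col.
have sP p' : p' \in s -> P p' by move=> p's; case/andP: (sP' _ p's).
apply/and3P; split; first by rewrite all_rcons p_ok.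
  case: s sok ssorted sP {s_col suniq sP'} => //= p' s sok ssorted sP.
  rewrite rcons_path ssorted p_least//.
    exact: (allP (sok : all part_ok (p' :: s))) (mem_last _ _).
  exact: sP (mem_last _ _).
rewrite filter_rcons; case: ifP => // p2.
rewrite map_rcons rcons_uniq suniq andbT; apply/mapP => -[p'].
rewrite mem_filter => /andP[p'2 p's] pE.
have /andP[_] := sP' _ p's; rewrite p2 /= => /eqP pp'.
by apply: pp'; rewrite [p']surjective_pairing [p]surjective_pairing -pE p2 p'2.
Qed.

(** Either [p] does not occur, or, being least, it is listed last and can be stripped off; appending
    [p] inverts this. *)
Lemma fps3_sum_remove_least (R : comUnitRingType) (F G : colpart -> fps3 R) :
    graded psize F ->
    (forall mu nu : colpart, above P' nu ->
       parts mu = rcons nu p -> F mu = G nu) ->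
  fps3_sum (above P) F =
    fps3_sum (above (fun p' => P p' && (p' != p))) F + fps3_sum (above P') G.
Proof.
move=> grF FG.
(* The default value [nu] is never taken on [above P'], where the extended list is again a colored
   partition. *)
pose add (nu : colpart) : colpart := insubd nu (rcons nu p).
have addE nu : above P' nu -> parts (add nu) = rcons nu p.
  by move=> nuP; rewrite [LHS]insubdK//; exact: is_colpart_rcons.
have P'P : subpred P' P by move=> p' /andP[].
rewrite (@eq_fps3_sum _ _ _ G (F \o add)); last first.
  by move=> nu nuP; rewrite -(FG (add nu) nu)// addE.
rewrite -(fps3_sum_image (h := add) (A := above P')); last first.
  move=> mu nu; rewrite !inE => muP nuP /(congr1 parts).
  by rewrite !addE// => /rcons_inj[] /val_inj.
rewrite -(fps3_sumU finite_psize grF); last first.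
  move=> mu [muP [nu nuP numu]]; move: muP.
  rewrite -numu /above /= addE// all_rcons => /andP[].
  by rewrite /= eqxx andbF.
congr (fps3_sum _ F); apply/seteqP; split=> mu; last first.
  case=> [|[nu nuP <-]]; first by rewrite /above /=; apply: sub_all => p' /andP[].
  rewrite /above /= addE// all_rcons Pp; exact: sub_all nuP.
rewrite /above /= => muP; have [pmu|pmu] := boolP (p \in parts mu); last first.
  left; apply/allP => p' p'mu; rewrite (allP muP)//=.
  by apply: contraNneq pmu => <-.
right.
suff [nu nuE nuP] : exists2 nu : colpart, parts mu = rcons nu p & above P' nu.
  by exists nu => //; apply: val_inj; rewrite [LHS]addE.
have : is_colpart (parts mu) by case: (mu).
have muok := @colpart_ok mu.
case/lastP: (parts mu) muP pmu muok => // s l; rewrite all_rcons.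
move=> /andP[Pl sP] psl slok /and3P[sok ssorted suniq].
(* The last part is below [p] by sortedness and above it by leastness. *)
have lp : l = p.
  apply: part_geq_anti.
    by apply: p_least => //; apply: slok; rewrite mem_rcons inE eqxx.
  move: psl; rewrite mem_rcons inE => /orP[/eqP ->|ps].
    by rewrite /part_geq eqxx implybb orbT.
  move: ssorted; rewrite (sorted_pairwise part_geq_trans) pairwise_rcons.
  by move=> /andP[/allP /(_ _ ps)].
subst l.
have s_col : is_colpart s.
  apply/and3P; split; first by move: sok; rewrite all_rcons => /andP[].
    by move: ssorted; rewrite -cats1 => /(cat_sorted2)[].
  move: suniq; rewrite filter_rcons; case: ifP => // _.
  by rewrite map_rcons rcons_uniq => /andP[].
exists (ColPart s_col) => //=; apply/allP => p' p's; rewrite /P' (allP sP)//=.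
apply/negP => /andP[p2 /eqP pp']; subst p'.
move: suniq; rewrite filter_rcons p2 map_rcons rcons_uniq => /andP[/negP + _].
by apply; apply/mapP; exists p => //; rewrite mem_filter p2.
Qed.

End RemoveLeast.

Lemma eq_above P Q : P =1 Q -> above P = above Q.
Proof. by move=> PQ; apply/seteqP; split=> mu; rewrite /above /= (eq_all PQ). Qed.

(* The color ab counts as 1: incrementing all parts maps parts_gt N onto      *)
(* parts_gt N.+1.                                                             *)
Definition parts_gt N : set colpart := above (fun p => p.2 + N < p.1)%N.

Lemma parts_gt0 : parts_gt 0 = setT.
Proof.
apply/seteqP; split=> // mu _; apply/allP => p /colpart_ok.
by rewrite /part_ok addn0; case: p.2.
Qed.

(** Two removals: the b-colored N + 1, which may repeat and so leaves a partition in [parts_gt N],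
    then the ab-colored N + 2, which leaves one in [parts_gt N.+1]. [G] and [H] are the summands
    after each removal. *)
Lemma fps3_sum_parts_gt (R : comUnitRingType) (F G H : colpart -> fps3 R) c d N :
    graded psize F -> graded psize G -> graded psize H ->
    (forall mu nu : colpart, parts mu = rcons nu (N.+1, false) ->
      F mu = d * G nu) ->
    (forall mu nu : colpart, parts mu = rcons nu (N.+2, true) ->
      F mu = c * H nu) ->
  fps3_sum (parts_gt N) F =
    fps3_sum (parts_gt N.+1) F + c * fps3_sum (parts_gt N.+1) H
    + d * fps3_sum (parts_gt N) G.
Proof.
move=> grF grG grH FG FH; rewrite !(fps3_sum_distrr finite_psize)//.
rewrite [LHS](@fps3_sum_remove_least _ (N.+1, false) _ _ _ _ F
  (fun mu => d * G mu))//; first last.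
- by move=> mu nu _; apply: FG.
- case=> k e _; rewrite /part_geq /= => ekN.
  move: ekN; case: e => /=; rewrite ?add1n ?add0n; first by move=> ->.
  by rewrite leq_eqVlt => /orP[->|->]; rewrite ?orbT.
congr (_ + _); last first.
  by congr (fps3_sum _ _); apply: eq_above => p'; rewrite andbT.
have PE : (fun p' : nat * bool =>
      [&& (p'.2 + N < p'.1)%N, p' != (N.+1, false) & p' != (N.+2, true)])
    =1 (fun p' => p'.2 + N.+1 < p'.1)%N.
  move=> [k e]; rewrite !xpair_eqE /=; case: e => /=; rewrite ?andbF ?andbT /=.
    by rewrite !add1n andbC eq_sym -ltn_neqAle.
  by rewrite !add0n andbC eq_sym -ltn_neqAle.
rewrite [LHS](@fps3_sum_remove_least _ (N.+2, true) _ _ _ _ F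
  (fun mu => c * H mu))//; first last.
- by move=> mu nu _; apply: FH.
- case=> k e _; rewrite /part_geq /= xpair_eqE => /andP[]; case: e => /=.
    by rewrite add1n leq_eqVlt => /orP[->|->]; rewrite ?orbT.
  rewrite add0n eqxx andbT => Nk kN.
  have : (N.+2 <= k)%N by rewrite ltn_neqAle eq_sym kN.
  by rewrite leq_eqVlt => /orP[->|->]; rewrite ?orbT.
- by rewrite xpair_eqE andbF /= add1n ltnSn.
congr (_ + _); congr (fps3_sum _ _);
  by apply: eq_above => p'; rewrite -PE -andbA.
Qed.

(** * The limit of the recurrence and the colored generating function *)

Section Limit.
Variables (R : comUnitRingType) (x y : fps3 R).
Local Notation q := (fps3_q R).

(** A single part already supplies q^N: its q-exponent is at least N for either color, the
    ab-colored bound being one larger. *)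
Lemma coef3_weight_parts_gt N mu (g : fps3 R) i j n :
    parts_gt N mu -> parts mu <> [::] -> (n < N)%N ->
  (weight x y q mu * g) i j n = 0.
Proof.
move=> muN; have : all (fun p : nat * bool => p.2 + N < p.1)%N (parts mu) := muN.
rewrite /weight; case: (parts mu) => // p s /andP[pN _] _ nN; rewrite big_cons.
set w := \prod_(_ <- _) _.
suff [h ->] : exists h, (if p.2 then x * y * q ^+ (p.1 - 2)
    else y * q ^+ (p.1 - 1)) = h * q ^+ N.
  by rewrite -[_ * w * g]mulrA mulrAC coef3_mulqXn.
case: p.2 pN => pN.
  exists (x * y * q ^+ (p.1 - 2 - N)); rewrite -[RHS]mulrA -exprD subnK//.
  by rewrite leq_subRL ?(leq_trans _ pN)// ltnS.
exists (y * q ^+ (p.1 - 1 - N)); rewrite -[RHS]mulrA -exprD subnK//.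
by rewrite leq_subRL ?(leq_trans _ pN).
Qed.

(** Below q^N only the empty partition contributes. The factor [g] covers both the plain weights and
    those multiplied by (c; q)_m. *)
Lemma fps3_sum_parts_gt_lim (g : nat -> fps3 R) N i j n :
    g 0%N = 1 -> (n < N)%N ->
  fps3_sum (parts_gt N) (fun mu => weight x y q mu * g (num_parts mu)) i j n
    = (1 : fps3 R) i j n.
Proof.
move=> g0 nN.
pose e := (ColPart (isT : is_colpart [::])).
transitivity (fps3_sum [set e] (fun mu => weight x y q mu * g (num_parts mu)) i j n).
  symmetry; apply: fsbig_widen => [_ -> //|mu [muN mue]].
  apply: coef3_weight_parts_gt muN _ nN => mu0; apply: mue; exact: val_inj.
change (\sum_(mu \in [set e]) (weight x y q mu * g (num_parts mu)) i j n
  = (1 : fps3 R) i j n).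
rewrite fsbig_set1; congr (coef_fps (coef_fps (coef_fps _ _) _) _).
by rewrite /weight big_nil g0 mul1r.
Qed.

End Limit.

Lemma recurrence_solve (S : comPzRingType) (Y u v z : S) :
  u = v + z * v + Y * u -> u * (1 - Y) = (1 + z) * v.
Proof. by move=> uE; rewrite mulrBr mulr1 {1}uE [u * Y]mulrC addrK mulrDl mul1r. Qed.

Section ColoredSums.
Variables (R : comUnitRingType) (x y : fps3 R).
Local Notation q := (fps3_q R).
Hypotheses (x1 : order_ge 1 x) (y1 : order_ge 1 y).

Lemma fps3_sum_weight_parts_gt N :
  fps3_sum (parts_gt N) (weight x y q) * (1 - y * q ^+ N)
    = (1 + x * y * q ^+ N) * fps3_sum (parts_gt N.+1) (weight x y q).
Proof.
have grw := graded_weight x1 y1; apply: recurrence_solve.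
apply: fps3_sum_parts_gt => //.
  by move=> mu nu /weight_rcons ->; rewrite mulrC subn1.
by move=> mu nu /weight_rcons ->; rewrite mulrC subn2.
Qed.

Lemma qpoch_sum_weight :
  fps3_sum setT (weight x y q) * qpoch y q = qpoch (- (x * y)) q.
Proof.
rewrite -parts_gt0.
apply: (qpoch_recurrence (U := fun N => fps3_sum (parts_gt N) (weight x y q))).
  by move=> N; rewrite fps3_sum_weight_parts_gt mulNr opprK.
move=> N i j n nN.
have -> : weight x y q = (fun mu => weight x y q mu * 1).
  by apply/funext => mu; rewrite mulr1.
exact: (fps3_sum_parts_gt_lim x y (g := fun=> 1)).
Qed.

End ColoredSums.

(** * Incrementing all parts and the q-binomial theorem *)

Definition incr_part (p : nat * bool) : nat * bool := (p.1.+1, p.2).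

Lemma is_colpart_incr (s : seq (nat * bool)) : all part_ok s ->
  is_colpart (map incr_part s) = is_colpart s.
Proof.
move=> sok; rewrite /is_colpart sok all_map sorted_map; congr [&& _, _ & _].
  by apply/allP => p /(allP sok); rewrite /part_ok /=; case: p.2 => // /ltnW.
by rewrite filter_map -map_comp -[RHS](map_inj_uniq succn_inj) -[in RHS]map_comp.
Qed.

Definition incr (mu : colpart) : colpart := insubd mu (map incr_part (parts mu)).

Lemma parts_incr mu : parts (incr mu) = map incr_part (parts mu).
Proof.
apply: insubdK; rewrite -[_ \in _]/(is_colpart _) is_colpart_incr.
  by case: mu.
by apply/allP => p; apply: colpart_ok.
Qed.

Lemma incr_inj : injective incr.
Proof.
move=> mu nu /(congr1 parts); rewrite !parts_incr => /inj_map munu.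
by apply/val_inj/munu => -[k e] [l f] [-> ->].
Qed.

Lemma incr_parts_gt N : incr @` parts_gt N = parts_gt N.+1.
Proof.
apply/seteqP; split=> [_ [mu muN <-]|mu muN].
  rewrite /parts_gt /above /= parts_incr all_map; apply: sub_all muN => p /=.
  by rewrite addnS ltnS.
pose s := [seq (p.1.-1, p.2) | p <- parts mu].
have sE : map incr_part s = parts mu.
  rewrite -map_comp -[RHS]map_id; apply/eq_in_map => p /(allP muN) /=.
  by rewrite /incr_part; case: p => [[|k] e].
have sok : all part_ok s.
  (* The extra 1 that [parts_gt] demands of color ab keeps a decremented ab-colored part at least
     2. *)
  apply/allP => p ps; have : incr_part p \in parts mu by rewrite -sE map_f.
  move=> /(allP muN); rewrite /part_ok /= addnS ltnS; case: p.2 => pN.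
    by rewrite (leq_ltn_trans _ pN)// leq_addr.
  exact: leq_ltn_trans pN.
have s_col : is_colpart s.
  by rewrite -is_colpart_incr// sE; case: (mu).
exists (ColPart s_col); last by apply: val_inj; rewrite /= parts_incr.
apply/allP => p ps; have : incr_part p \in parts mu by rewrite -sE map_f.
by move=> /(allP muN); rewrite /= addnS ltnS.
Qed.

Lemma weight_incr (S : comNzRingType) (x y q : S) mu :
  weight x y q (incr mu) = q ^+ num_parts mu * weight x y q mu.
Proof.
rewrite /weight /num_parts parts_incr big_map; have := @colpart_ok mu.
elim: (parts mu) => [|p s IH] sok; first by rewrite !big_nil mulr1.
rewrite !big_cons IH => [|p' p's]; last by apply: sok; rewrite inE p's orbT.
rewrite exprS [RHS]mulrACA; congr (_ * _).
have := sok p; rewrite inE eqxx => /(_ isT); rewrite /part_ok /=.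
by case: p.2 => pok; rewrite subSn// exprS mulrCA.
Qed.

Lemma Pochhammer_step (S : comPzRingType) (w p c t : S) :
  w * (p * (1 - c * t)) = w * p + - c * (t * (w * p)).
Proof. by rewrite mulrA mulrBr mulr1 mulNr [_ * (c * t)]mulrC -mulrA. Qed.

Lemma recurrence_qfact (S : comPzRingType) (c y t u v z : S) :
    u = v + 0 * z + y * t * (u + - c * v) ->
  u * (1 - y * t) = (1 - c * y * t) * v.
Proof.
move=> uE; apply: recurrence_solve; rewrite {1}uE mul0r addr0 mulrDr addrCA addrC.
by rewrite [y * t * (_ * v)]mulrA mulrN [y * t * c]mulrC [c * (y * t)]mulrA.
Qed.

Section QBinomial.
Variables (R : comUnitRingType) (c y : fps3 R).
Hypothesis y1 : order_ge 1 y.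
Local Notation q := (fps3_q R).

Let P k := \prod_(i < k) (1 - c * q ^+ i).
Let F (mu : colpart) := weight 0 y q mu * P (num_parts mu).
Let G (mu : colpart) := weight 0 y q mu * P (num_parts mu).+1.

Let grF : graded psize F.
Proof.
by move=> mu; apply: order_geMr; apply: graded_weight => //; apply: order_ge0.
Qed.

Let grG : graded psize G.
Proof.
by move=> mu; apply: order_geMr; apply: graded_weight => //; apply: order_ge0.
Qed.

Let F_incr mu : (F \o incr) mu = q ^+ num_parts mu * F mu.
Proof.
by rewrite /F /= weight_incr mulrA /num_parts parts_incr size_map.
Qed.

Let G_incr mu : G mu = F mu + - c * (F \o incr) mu.
Proof. by rewrite F_incr /G /P big_ord_recr; apply: Pochhammer_step. Qed.

(** Write (c; q)_(m+1) as (c; q)_m - c q^m (c; q)_m. Incrementing all m parts absorbs the factor q^m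
    and moves the second sum to [parts_gt N.+1]. *)
Let sumG N : fps3_sum (parts_gt N) G =
  fps3_sum (parts_gt N) F + - c * fps3_sum (parts_gt N.+1) F.
Proof.
have grFi : graded psize (F \o incr).
  by move=> mu; rewrite F_incr mulrC; apply: order_geMr.
rewrite -incr_parts_gt fps3_sum_image; last first.
  by move=> mu nu _ _; apply: incr_inj.
rewrite (fps3_sum_distrr finite_psize)//.
rewrite -(fps3_sumD finite_psize _ grF (graded_mull _ grFi)).
by apply: eq_fps3_sum => mu _; apply: G_incr.
Qed.

(** Removing a part lowers the number of parts by one while the Pochhammer factor stays, so the
    summand left is [G], which [sumG] expresses through [F]. The ab-colored removal has coefficient
    0. *)
Lemma fps3_sum_qfact_parts_gt N :
  fps3_sum (parts_gt N) F * (1 - y * q ^+ N)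
    = (1 - c * y * q ^+ N) * fps3_sum (parts_gt N.+1) F.
Proof.
apply: (recurrence_qfact (z := fps3_sum (parts_gt N.+1) F)); rewrite -sumG.
apply: (fps3_sum_parts_gt grF grG grF) => mu nu munu.
  rewrite /F /G (weight_rcons _ _ munu) /num_parts munu size_rcons subn1.
  by rewrite mulrAC mulrC.
by rewrite /F (weight_rcons _ _ munu) /= !mul0r mulr0 mul0r.
Qed.

(** The q-binomial theorem: ordinary partitions with m parts have total weight y^m / (q; q)_m. *)
Lemma qpoch_sum_qfact :
  fps3_sum setT F * qpoch y q = qpoch (c * y) q.
Proof.
rewrite -parts_gt0.
apply: (qpoch_recurrence (U := fun N => fps3_sum (parts_gt N) F)).
  exact: fps3_sum_qfact_parts_gt.
move=> N i j n nN; apply: (fps3_sum_parts_gt_lim 0 y (g := P)) => //.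
exact: big_ord0.
Qed.

End QBinomial.

(** * Sums over pairs of partitions *)

Lemma smallest_part_le (mu : colpart) p :
  p \in parts mu -> (smallest_part mu <= p.1)%N.
Proof.
rewrite /smallest_part.
have : is_colpart (parts mu) by case: (mu).
case/lastP: (parts mu) => // s l /and3P[_ ssorted _].
rewrite map_rcons last_rcons mem_rcons inE => /orP[/eqP -> //|ps].
move: ssorted; rewrite (sorted_pairwise part_geq_trans) pairwise_rcons.
move=> /andP[/allP /(_ _ ps) + _].
by rewrite /part_geq => /orP[/ltnW //|/andP[/eqP ->]].
Qed.

Lemma smallest_part_mem (mu : colpart) : parts mu <> [::] ->
  exists2 p, p \in parts mu & smallest_part mu = p.1.
Proof.
rewrite /smallest_part; case/lastP: (parts mu) => // s l _; exists l.
  by rewrite mem_rcons inE eqxx.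
by rewrite map_rcons last_rcons.
Qed.

Section PairSums.
Variables (R : comUnitRingType) (x y z : fps3 R).
Local Notation q := (fps3_q R).
Hypotheses (x1 : order_ge 1 x) (y1 : order_ge 1 y) (z1 : order_ge 1 z).

Let grw0z : graded psize (weight 0 z q).
Proof. by apply: graded_weight => //; apply: order_ge0. Qed.

Let S0 := fps3_sum setT (weight 0 z q).

Lemma sum_weight_frakF :
  fps3_sum (frakF 0 z `*` frakF x y)
    (fun p => weight 0 z q p.1 * weight x y q p.2)
  = S0 * fps3_sum setT (weight x y q).
Proof.
have grw := graded_weight x1 y1.
rewrite (@fps3_sum_widen _ _ _ [set p : colpart * colpart | [set: colpart] p.1])//.
  rewrite (fps3_sum_dep (fun=> setT) finite_psize finite_psize grw0z grw).
  by rewrite (fps3_sum_distrr finite_psize _ S0 grw).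
move=> [la mu] _ /not_andP[] /weight_notin_frakF /= ->; first by rewrite mul0r.
by rewrite mulr0.
Qed.

Lemma fps3_sum_weight0_parts_gt N :
  fps3_sum (parts_gt N) (weight 0 z q) = S0 * \prod_(k < N) (1 - z * q ^+ k).
Proof.
have rec n : fps3_sum (parts_gt n) (weight 0 z q) * (1 - z * q ^+ n)
    = 1 * fps3_sum (parts_gt n.+1) (weight 0 z q).
  apply: etrans (fps3_sum_weight_parts_gt (@order_ge0 R 1) z1 n) _.
  by rewrite (mul0r z) mul0r addr0.
have := prod_recurrence rec N; rewrite parts_gt0 => ->.
by rewrite big1// mul1r.
Qed.

Lemma sum_weight_frakF4 :
  fps3_sum (frakF4 0 z 0 y) (fun p => weight 0 z q p.1 * weight 0 y q p.2)
  = S0 * fps3_sum setT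
      (fun mu => weight 0 y q mu * \prod_(k < num_parts mu) (1 - z * q ^+ k)).
Proof.
have grw : graded psize (weight 0 y q).
  by apply: graded_weight => //; apply: order_ge0.
(* On pairs of ordinary partitions the smallest-part condition says exactly that all parts of lambda
   exceed the number of parts of mu; the pairs added here have an ab-colored part and weight 0. *)
rewrite (@fps3_sum_widen _ _ _
  [set p : colpart * colpart | parts_gt (num_parts p.2) p.1]).
- rewrite (fps3_sum_dep (fun mu => parts_gt (num_parts mu))
    finite_psize finite_psize grw0z grw).
  have grF : graded psize (fun mu =>
      weight 0 y q mu * \prod_(k < num_parts mu) (1 - z * q ^+ k)).
    by move=> mu; apply: order_geMr; apply: grw.
  rewrite (fps3_sum_distrr finite_psize _ S0 grF).
  apply: eq_fps3_sum => mu _; rewrite fps3_sum_weight0_parts_gt.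
  by rewrite -mulrA [_ * weight _ _ _ _]mulrC.
- move=> [la mu] [/= /(_ erefl) lab _ smallest]; apply/allP => p pla.
  rewrite (negbTE (lab p pla)) add0n.
  case: smallest => [la0|]; first by move: pla; rewrite la0.
  by move=> /leq_trans; apply; apply: smallest_part_le.
- move=> [la mu] /= la_gt /not_and3P[||].
  + by move=> /weight_notin_frakF ->; rewrite mul0r.
  + by move=> /weight_notin_frakF ->; rewrite mulr0.
  + move=> /not_orP[/smallest_part_mem[p pla ->]] []; move: (allP la_gt p pla).
    by apply: leq_ltn_trans; apply: leq_addl.
Qed.

End PairSums.

Lemma mulr_divr2 (S : comUnitRingType) (s u v w x : S) :
    v \is a GRing.unit -> w \is a GRing.unit ->
  s * v = 1 -> u * w = x -> s * u = x / (v * w).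
Proof.
move=> vU wU sv <-; apply: canRL (mulrK _) _; first by rewrite unitrM vU.
by rewrite mulrACA sv mul1r.
Qed.
Theorem theorem3p3 (R : comUnitRingType) :
  let a : fps3 R := fps3_a R in
  let b : fps3 R := fps3_b R in
  let q : fps3 R := fps3_q R in
  let F1 (p : colpart * colpart) := weight 0 a q p.1 * weight (- a) b q p.2 in
  let F2 (p : colpart * colpart) := weight 0 a q p.1 * weight 0 b q p.2 in
  [/\ fps3_summable (frakF 0 a `*` frakF (- a) b) F1,
      fps3_summable (frakF4 0 a 0 b) F2,
      fps3_sum (frakF 0 a `*` frakF (- a) b) F1
        = qpoch (a * b) q / (qpoch a q * qpoch b q) &
      qpoch (a * b) q / (qpoch a q * qpoch b q)
        = fps3_sum (frakF4 0 a 0 b) F2].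
Proof.
move=> a b q F1 F2.
have a1 : order_ge 1 a := @order_ge_a R.
have b1 : order_ge 1 b := @order_ge_b R.
have na1 : order_ge 1 (- a) by apply: order_geN.
have o1 : order_ge 1 (0 : fps3 R) := @order_ge0 R 1.
have aU : qpoch a q \is a GRing.unit by apply: qpoch_unit; apply: a1.
have bU : qpoch b q \is a GRing.unit by apply: qpoch_unit; apply: b1.
(* With first parameter 0 the numerator is (0; q)_oo = 1. *)
have sum0 : fps3_sum setT (weight 0 a q) * qpoch a q = 1.
  by rewrite qpoch_sum_weight// mul0r oppr0 qpoch0.
pose psize2 (p : colpart * colpart) := (psize p.1 + psize p.2)%N.
have fin2 K : finite_set [set p | psize2 p <= K]%N.
  apply: sub_finite_set (finite_setX (finite_psize K) (finite_psize K)).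
  move=> p /= pK; split=> /=; apply: leq_trans pK; first exact: leq_addr.
  exact: leq_addl.
have gr2 x y : order_ge 1 x -> order_ge 1 y -> graded psize2
    (fun p => weight 0 a q p.1 * weight x y q p.2).
  by move=> x1 y1 p; apply: order_geM; apply: graded_weight.
split.
- exact: (graded_summable fin2 _ (gr2 (- a) b na1 b1)).
- exact: (graded_summable fin2 _ (gr2 0 b o1 b1)).
- apply: etrans (sum_weight_frakF na1 b1 a1) _; apply: mulr_divr2 aU bU sum0 _.
  by apply: etrans (qpoch_sum_weight na1 b1) _; rewrite mulNr opprK.
- symmetry; apply: etrans (sum_weight_frakF4 b1 a1) _.
  exact: mulr_divr2 aU bU sum0 (qpoch_sum_qfact a b1).
Qed.
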